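(* Let $f=u+iv$ with $u,v\in C_0^\infty(\mathbb R^n)$ real-valued, and let $p,q,n$ satisfy $0<q<2<p$ and $2<n<\frac{2(p-q)}{p-2}$. Then $$\int_{\mathbb R^n} |\nabla f(x)|^2\, dx \int_{\mathbb R^n}\frac{|f(x)|^{2p-2}}{|x|^{2q-2}}\, dx \;\geq\; \frac{(n-q)^2}{p^2}\left(\int_{\mathbb R^n} \frac{|f(x)|^p}{|x|^q}\,dx\right)^2 +\mathrm{COV}^2,$$ where $$\mathrm{COV}=\int_{\mathbb R^n}\frac{|f(x)|^p}{|x|^{q-1}}\,\left|\Phi_f'(x)\right| dx .$$
   Context: $C_0^\infty(\mathbb R^n)$ denotes the smooth functions with compact support in $\mathbb R^n$. $\nabla=(\partial_1,\dots,\partial_n)^T$ is the gradient, and for complex-valued $f$, $|\nabla f(x)|$ is the Hermitian norm in $\mathbb C^n$, i.e. $|\nabla f|^2=|\nabla u|^2+|\nabla v|^2$. Phase derivative of a complex-valued function $f=u+iv$ on $\mathbb R^n$: at points where $f(x)\neq 0$, $$\Phi_f'(x)=\frac{\nabla f(x)}{2i f(x)}-\frac{\nabla \overline{f(x)}}{2i\,\overline{f(x)}}=\frac{u(x)\nabla v(x)-v(x)\nabla u(x)}{|f(x)|^2}\in\mathbb R^n .$$ Integrands containing the product of a positive power of $|f(x)|$ with $\Phi_f'(x)$ are taken to be $0$ at points where $f(x)=0$. *)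

(* Defs.v *)
From HB Require Import structures.
From mathcomp Require Import all_boot all_order all_algebra.
From mathcomp Require Import ring complex.
From mathcomp Require Import all_classical all_reals all_analysis.

Set Implicit Arguments.
Unset Strict Implicit.
Unset Printing Implicit Defensive.

Import Order.TTheory GRing.Theory Num.Theory.
Import numFieldNormedType.Exports.

Local Open Scope classical_set_scope.
Local Open Scope complex_scope.
Local Open Scope ring_scope.

(* R^n is 'rV[R]_n, with the sigma-algebra generated by the coordinates, which
   is what the library puts on tuples. *)

Definition measure_rV_display : measure_display -> measure_display.
Proof. exact. Qed.

Section measurable_rV.
Context {d : measure_display} {T : measurableType d}.
Variable n : nat.

Definition coord_rV (i : 'I_n) (x : 'rV[T]_n) : T := x ord0 i.

Let rV_set0 : g_sigma_preimage coord_rV set0.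
Proof. exact: sigma_algebra0. Qed.

Let rV_setC A : g_sigma_preimage coord_rV A -> g_sigma_preimage coord_rV (~` A).
Proof. exact: sigma_algebraC. Qed.

Let rV_bigcup (F : (set 'rV[T]_n)^nat) :
  (forall i, g_sigma_preimage coord_rV (F i)) ->
  g_sigma_preimage coord_rV (\bigcup_i (F i)).
Proof. exact: sigma_algebra_bigcup. Qed.

HB.instance Definition _ := @isMeasurable.Build (measure_rV_display d)
  'rV[T]_n (g_sigma_preimage coord_rV) rV_set0 rV_setC rV_bigcup.

Lemma measurable_coord_rV (i : 'I_n) : measurable_fun setT (coord_rV i).
Proof.
move=> _ Y mY; rewrite setTI; apply: sub_sigma_algebra => /=.
rewrite -bigcup_seq/=; exists i => /=; first by rewrite mem_index_enum.
by exists Y => //; rewrite setTI.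
Qed.

Lemma measurable_fun_rVP d' (S : measurableType d') (f : S -> 'rV[T]_n) :
  (forall i, measurable_fun setT (fun x => coord_rV i (f x))) ->
  measurable_fun setT f.
Proof.
move=> mf; apply: (@measurability _ _ _ _ _ _
  (\big[setU/set0]_(i < n) preimage_set_system setT (coord_rV i) measurable)).
  by [].
move=> _ [B + <-]; rewrite -bigcup_seq => -[i _ [C mC <-]].
by rewrite setTI; exact: mf.
Qed.

End measurable_rV.

Section row_cons.
Context {d : measure_display} {T : measurableType d}.
Variable n : nat.

Definition row_cons (p : T * 'rV[T]_n) : 'rV[T]_n.+1 :=
  row_mx (const_mx p.1 : 'rV[T]_1) p.2.

Definition row_uncons (x : 'rV[T]_n.+1) : T * 'rV[T]_n :=
  (x ord0 ord0, \row_j x ord0 (lift ord0 j)).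

Lemma row_cons0 p : row_cons p ord0 ord0 = p.1.
Proof.
rewrite /row_cons (_ : ord0 = lshift n (ord0 : 'I_1)); last exact: val_inj.
by rewrite (@row_mxEl _ _ 1) mxE.
Qed.

Lemma row_cons_lift p j : row_cons p ord0 (lift ord0 j) = p.2 ord0 j.
Proof.
rewrite /row_cons (_ : lift ord0 j = rshift 1 j); last exact: val_inj.
by rewrite (@row_mxEr _ _ 1).
Qed.

Lemma row_consK : cancel row_cons row_uncons.
Proof.
move=> p; rewrite /row_uncons row_cons0 [RHS]surjective_pairing; congr pair.
by apply/rowP => j; rewrite mxE row_cons_lift.
Qed.

Lemma measurable_row_cons : measurable_fun setT row_cons.
Proof.
apply: measurable_fun_rVP => i; rewrite /coord_rV.
have [j ->|->] := unliftP ord0 i.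
  under eq_fun do rewrite row_cons_lift.
  exact: (measurableT_comp (measurable_coord_rV j) measurable_snd).
by under eq_fun do rewrite row_cons0; exact: measurable_fst.
Qed.

Lemma measurable_row_uncons : measurable_fun setT row_uncons.
Proof.
apply: measurable_fun_pair; first exact: measurable_coord_rV.
apply: measurable_fun_rVP => i.
rewrite (_ : (fun x => _) = coord_rV (lift ord0 i)); first exact: measurable_coord_rV.
by apply/funext => x; rewrite /coord_rV/= mxE.
Qed.

End row_cons.

Section lebesgue_cons.
Context {R : realType} {n : nat}.
Local Open Scope ereal_scope.
Local Notation T := (measurableTypeR R).
Variable m : {sigma_finite_measure set 'rV[T]_n -> \bar R}.

Definition lebesgue_cons : set 'rV[T]_n.+1 -> \bar R :=
  pushforward (@lebesgue_measure R \x m) (@row_cons _ T n).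

Let lebesgue_cons0 : lebesgue_cons set0 = 0.
Proof. by rewrite /lebesgue_cons /pushforward preimage_set0 measure0. Qed.

Let lebesgue_cons_ge0 A : 0 <= lebesgue_cons A.
Proof. by rewrite /lebesgue_cons /pushforward measure_ge0. Qed.

Let lebesgue_cons_sigma_additive : semi_sigma_additive lebesgue_cons.
Proof.
have mf := @measurable_row_cons _ T n.
exact: measure_semi_sigma_additive.
Qed.

HB.instance Definition _ := isMeasure.Build _ _ _ lebesgue_cons
  lebesgue_cons0 lebesgue_cons_ge0 lebesgue_cons_sigma_additive.

Let lebesgue_cons_sigma_finite : sigma_finite setT lebesgue_cons.
Proof.
have /sigma_finiteP[F [TF ndF Foo]] := sigma_finiteT (@lebesgue_measure R).
have /sigma_finiteP[G [TG ndG Goo]] := sigma_finiteT m.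
exists (fun k => @row_uncons _ T n @^-1` (F k `*` G k)).
  rewrite -preimage_bigcup (_ : \bigcup_i _ = setT) ?preimage_setT//.
  apply/seteqP; split => // -[x y] _.
  have [k _ Fkx] : (\bigcup_i F i) x by rewrite -TF.
  have [l _ Gly] : (\bigcup_i G i) y by rewrite -TG.
  exists (maxn k l) => //; split => /=.
  - by move: x Fkx; exact/subsetPset/ndF/leq_maxl.
  - by move: y Gly; exact/subsetPset/ndG/leq_maxr.
move=> k; have [mF Fk] := Foo k; have [mG Gk] := Goo k; split.
  rewrite -[X in measurable X]setTI; apply: measurable_row_uncons => //.
  exact: measurableX.
rewrite /lebesgue_cons /pushforward -comp_preimage.
rewrite (_ : @row_uncons _ T n \o _ = id); last by apply/funext => x; exact: row_consK.
by rewrite preimage_id product_measure1E// lte_mul_pinfty// ge0_fin_numE.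
Qed.

HB.instance Definition _ := Measure_isSigmaFinite.Build _ _ _ lebesgue_cons
  lebesgue_cons_sigma_finite.

End lebesgue_cons.

(* n-dimensional Lebesgue measure: the n-fold product of the one-dimensional
   one, characterized by its values on boxes in [lebesgue_rV_box]. *)
Fixpoint lebesgue_rV (R : realType) (n : nat) :
    {sigma_finite_measure set 'rV[measurableTypeR R]_n -> \bar R} :=
  match n with
  | 0 => @dirac _ 'rV[measurableTypeR R]_0 (0 : 'rV[R]_0) R
  | k.+1 => lebesgue_cons (lebesgue_rV R k)
  end.
Arguments lebesgue_rV {R} n.

Lemma lebesgue_rV_box (R : realType) (n : nat)
    (A : 'I_n -> set (measurableTypeR R)) :
  (forall i, measurable (A i)) ->
  (lebesgue_rV n [set x | forall i, A i (x ord0 i)] =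
   \prod_(i < n) lebesgue_measure (A i))%E.
Proof.
elim: n A => [|n IHn] A mA.
  rewrite big_ord0/= diracE mem_set//; by case.
rewrite big_ord_recl -IHn//=.
pose B := [set x : 'rV[measurableTypeR R]_n | forall i, A (lift ord0 i) (x ord0 i)].
have mB : measurable B.
  rewrite (_ : B =
    \bigcap_(i in [set: 'I_n]) (coord_rV i @^-1` A (lift ord0 i))).
    apply: fin_bigcap_measurable => // i _.
    by rewrite -[X in measurable X]setTI; exact: measurable_coord_rV.
  by apply/seteqP; split => [x xA i _|x xA i]; [exact: xA|exact: xA].
rewrite -[X in (_ * lebesgue_rV n X)%E]/B -product_measure1E//.
congr product_measure1; apply/seteqP; split => p /=.
  move=> pA; split; first by move: (pA ord0); rewrite row_cons0.
  by move=> i; move: (pA (lift ord0 i)); rewrite row_cons_lift.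
move=> [pA0 pA] i; have [j ->|->] := unliftP ord0 i.
  by rewrite row_cons_lift.
by rewrite row_cons0.
Qed.

Section calculus.
Context {R : realType} {n : nat}.
Implicit Types (g : 'rV[R]_n -> R) (f : 'rV[R]_n -> R[i]).

Definition partial (j : 'I_n) g : 'rV[R]_n -> R := 'D_(delta_mx ord0 j) g.

Definition iter_partial (s : seq 'I_n) g : 'rV[R]_n -> R := foldr partial g s.

Definition smooth g : Prop :=
  forall s : seq 'I_n, continuous (iter_partial s g) /\
    forall x j, derivable (iter_partial s g) x (delta_mx ord0 j).

Definition smooth_compact_support g : Prop :=
  smooth g /\ compact (closure [set x | g x != 0]).

Definition grad g (x : 'rV[R]_n) : 'rV[R]_n := \row_j partial j g x.

Definition cgrad f (x : 'rV[R]_n) : 'rV[R[i]]_n :=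
  \row_j (partial j (fun y => complex.Re (f y)) x
            +i* partial j (fun y => complex.Im (f y)) x).

(* The library's norm on row vectors is the sup norm. *)
Definition enorm (x : 'rV[R]_n) : R := Num.sqrt (\sum_j x ord0 j ^+ 2).

(* The modulus on [R[i]] with values in [R]; the library's norm `|_| on [R[i]]
   takes its values in [R[i]]. *)
Definition cmod (z : R[i]) : R := ComplexField.Normc.normc z.

Definition hnorm (z : 'rV[R[i]]_n) : R :=
  Num.sqrt (\sum_j cmod (z ord0 j) ^+ 2).

Lemma hnorm_cgrad f x : hnorm (cgrad f x) ^+ 2 =
  enorm (grad (fun y => complex.Re (f y)) x) ^+ 2 +
  enorm (grad (fun y => complex.Im (f y)) x) ^+ 2.
Proof.
rewrite !sqr_sqrtr ?sumr_ge0//; try by move=> j _; exact: sqr_ge0.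
rewrite -big_split; apply: eq_bigr => j _ /=; rewrite !mxE /cmod /=.
by rewrite sqr_sqrtr// addr_ge0 ?sqr_ge0.
Qed.

(* At a zero of [f] the value is 0, as division by 0 yields 0. *)
Definition phase_deriv f (x : 'rV[R]_n) : 'rV[R]_n :=
  \row_j ((complex.Re (f x) * partial j (fun y => complex.Im (f y)) x
           - complex.Im (f x) * partial j (fun y => complex.Re (f y)) x)
          / cmod (f x) ^+ 2).

Lemma phase_derivE f x j : f x != 0 ->
  derivable (fun y => complex.Im (f y)) x (delta_mx ord0 j) ->
  (phase_deriv f x ord0 j)%:C =
    cgrad f x ord0 j / (2 * 'i%C * f x)
    - cgrad (fun y => (f y)^*%C) x ord0 j / (2 * 'i%C * (f x)^*%C).
Proof.
move=> fx0 dIm; rewrite !mxE.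
have -> : partial j (fun y => complex.Re (f y)^*%C) x =
          partial j (fun y => complex.Re (f y)) x.
  by congr (partial j _ x); apply/funext => y; case: (f y).
have -> : partial j (fun y => complex.Im (f y)^*%C) x =
          - partial j (fun y => complex.Im (f y)) x.
  rewrite -[RHS](deriveN dIm); congr (partial j _ x); apply/funext => y /=.
  by transitivity (- complex.Im (f y)); first by case: (f y).
case: (f x) fx0 => a b /= ab0.
move: (partial j _ x) (partial j _ x) => a' b'.
have iE (c d : R) : (c +i* d)%C = c%:C + 'i%C * d%:C by exact: complexE.
have ci0 : a%:C - 'i%C * b%:C != 0.
  apply: contra ab0 => /eqP ab; rewrite -conjc_eq0 /= iE.
  by rewrite rmorphN mulrN ab.
have c0 : a%:C + 'i%C * b%:C != 0 by rewrite -iE.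
have i0 : 'i%C != 0 :> R[i] by rewrite eq_complex /= oner_eq0 andbF.
rewrite (iE a b) (iE a (- b)) (iE a' b') (iE a' (- b')) !rmorphN /= !mulrN.
rewrite /cmod /= sqr_sqrtr ?addr_ge0 ?sqr_ge0//.
have N : (a ^+ 2 + b ^+ 2)%:C =
    (a%:C + 'i%C * b%:C) * (a%:C - 'i%C * b%:C).
  have := sqr_i R => ii; rewrite rmorphD !rmorphXn /=.
  by rewrite mulrC -subr_sqr exprMn ii mulN1r opprK.
rewrite fmorph_div /= N rmorphB !rmorphM /=; field; last by rewrite i0 c0 ci0.
Qed.

End calculus.

Section integrals.
Context {R : realType} {n : nat}.
Variables (p q : R) (f : 'rV[R]_n -> R[i]).
Local Open Scope ereal_scope.

(* Integral of a nonnegative function, in the extended reals; the value of the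
   weight at x = 0 is immaterial, the origin being a null set when n > 0. *)
Definition COV : \bar R :=
  \int[lebesgue_rV n]_x
    (cmod (f x) `^ p / enorm x `^ (q - 1) * enorm (phase_deriv f x))%:E.

End integrals.

(* Main.v *)
Require Import Defs.
From mathcomp Require Import all_boot all_order all_algebra.
From mathcomp Require Import complex ring lra.
From mathcomp Require Import all_classical all_reals all_analysis.
From mathcomp Require Import measurable_realfun.

Set Implicit Arguments.
Unset Strict Implicit.
Unset Printing Implicit Defensive.

Import Order.TTheory GRing.Theory Num.Theory.
Import numFieldNormedType.Exports.

Local Open Scope classical_set_scope.
Local Open Scope complex_scope.
Local Open Scope ring_scope.

(** Where [f] does not vanish, its gradient splits orthogonally into the
    gradient of the modulus and the modulus times the phase derivative:
    [|grad f|^2 = a^2 + b^2] with [a = |grad |f||] and [b = |f| |Phi_f'|].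
    Put [B = |f|^(p-1) / |x|^(q-1)], so that the second factor of the product
    is the integral of [B^2]. Cauchy-Schwarz, used once for [a] and once for
    [b], bounds the product from below by
    [(\int a B)^2 + (\int b B)^2]; the second integral is COV, and it remains
    to see that [\int a B >= (n - q) / p * \int |f|^p / |x|^q].

    This is a weighted Hardy inequality ([hardy_weighted]). Since
    [div (x / |x|^q) = (n - q) / |x|^q], integrating by parts against
    [|f|^p] gives [(n - q) \int |f|^p / |x|^q <=
    \int |grad (|f|^p)| / |x|^(q-1)], and [|grad (|f|^p)| = p |f|^(p-1) a].
    The field [x / |x|^q] is singular at the origin, so it is first replaced by
    [x (|x|^2 + e)^(-q/2)] ([hardy_regularized]), whose divergence is still at
    least [(n - q) (|x|^2 + e)^(-q/2)] because [q > 0]; Fatou's lemma then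
    removes [e]. The power [|f|^p = (u^2 + v^2)^(p/2)] is differentiated as a
    [C^1] function, zeros of [f] included, because [p/2 > 1].

    The integration by parts itself is the vanishing of the integral of a
    partial derivative of a compactly supported [C^1] function
    ([integral_partial_eq0]): an induction on the dimension through Fubini's
    theorem, with the fundamental theorem of calculus along the differentiated
    coordinate. Apart from these compactly supported integrands, all integrands
    are nonnegative and their integrals are taken in the extended reals. *)

(** * Continuous functions on the space of row vectors *)

Lemma cvg_coord_rV (R : realType) (n : nat) (T : Type) (F : set_system T)
    {FF : Filter F} (f : T -> 'rV[R]_n) (l : 'rV[R]_n) :
  (forall j, f x ord0 j @[x --> F] --> l ord0 j) -> f x @[x --> F] --> l.
Proof.
move=> fl; apply/cvgrPdist_le => /= e e0; near=> x.
rewrite /Num.Def.normr/= mx_normrE (bigmax_le _ (ltW e0))//= => -[i j] _.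
rewrite !mxE/= ord1; move: j; near: x; apply: filter_forall => /= j.
exact: (cvgrPdist_le _ _).1 (fl j) e e0.
Unshelve. all: by end_near. Qed.

(** The Borel sets of [R^n] have to be related to the sigma-algebra generated by
    the coordinates. Rounding the coordinates down to multiples of [1/(k+1)]
    makes a continuous function take countably many values, each on a countable
    union of cells cut out by coordinates; the function is the pointwise limit
    of these step functions. *)
Section measurable_continuous.
Context {R : realType} {n : nat}.
Local Notation T := (measurableTypeR R).

Let grid (k : nat) (z : 'rV[int]_n) : 'rV[R]_n :=
  \row_j ((z ord0 j)%:~R / k.+1%:R).

Let cell (k : nat) (x : 'rV[R]_n) : 'rV[int]_n :=
  \row_j Num.floor (x ord0 j * k.+1%:R).

Let grid_cell_cvg (x : 'rV[R]_n) : grid k (cell k x) @[k --> \oo] --> x.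
Proof.
apply: cvg_coord_rV => j; apply/cvgrPdist_le => /= e e0; near=> k.
rewrite !mxE; have k0 : 0 < k.+1%:R :> R by rewrite ltr0n.
have /andP[h1 h2] := floor_itv (x ord0 j * k.+1%:R).
rewrite intrD in h2.
rewrite -{1}(mulfK (lt0r_neq0 k0) (x ord0 j)) -mulrBl normrM ger0_norm ?subr_ge0//.
rewrite ger0_norm ?invr_ge0 ?(ltW k0)// ler_pdivrMr//.
apply: (@le_trans _ _ 1); first by rewrite lerBlDl ltW.
rewrite -ler_pdivrMr// mul1r; apply: ltW.
by near: k; exact: (near_infty_natSinv_lt (PosNum e0)).
Unshelve. all: by end_near. Qed.

Let measurable_cell (k : nat) (z : 'rV[int]_n) :
  measurable (cell k @^-1` [set z] : set 'rV[T]_n).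
Proof.
rewrite (_ : _ @^-1` _ = \bigcap_(j in [set: 'I_n])
   (@coord_rV _ T n j @^-1` (`[(z ord0 j)%:~R / k.+1%:R,
                           (z ord0 j + 1)%:~R / k.+1%:R[%classic : set R))).
  apply: fin_bigcap_measurable => // j _.
  rewrite -[X in measurable X]setTI; exact: measurable_coord_rV.
have k0 : 0 < k.+1%:R :> R by rewrite ltr0n.
apply/seteqP; split => [x /= <- j _|x /= xz].
  rewrite /= in_itv/= !mxE /coord_rV ler_pdivrMr// ltr_pdivlMr//.
  exact: floor_itv.
apply/rowP => j; rewrite mxE; apply: floor_def.
by have := xz j I; rewrite /= in_itv/= ler_pdivrMr// ltr_pdivlMr.
Qed.

Lemma continuous_measurable_rV (f : 'rV[R]_n -> R) : continuous f ->
  measurable_fun [set: 'rV[T]_n] f.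
Proof.
move=> cf; pose h k x := f (grid k (cell k x)).
apply: (@measurable_fun_cvg _ _ _ _ h) => [k _ B mB|x _].
  rewrite setTI (_ : _ @^-1` _ =
    \bigcup_z [set x : 'rV[T]_n | cell k x = z /\ B (f (grid k z))]).
    apply: countable_bigcupT_measurable => // z.
    have [Bz|nBz] := pselect (B (f (grid k z))).
      rewrite (_ : mkset _ = cell k @^-1` [set z]); first exact: measurable_cell.
      by apply/seteqP; split => [x []//|x].
    rewrite (_ : mkset _ = set0); first exact: measurable0.
    by apply/seteqP; split => [x []|x].
  apply/seteqP; split => [x Bx|x [z _ [<-]]//].
  by exists (cell k x).
apply: (@cvg_comp _ _ _ (fun k => grid k (cell k x)) f _ (nbhs x)).
  exact: grid_cell_cvg.
exact: cf.
Qed.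

End measurable_continuous.

Lemma continuous_box_bounded (R : realType) (n : nat) (f : 'rV[R]_n -> R) (M : R) :
  continuous f -> (forall (x : 'rV[R]_n) i, M < `|x ord0 i| -> f x = 0) ->
  exists C, forall x, `|f x| <= C.
Proof.
move=> cf fM.
pose A := [set x : 'rV[R]_n | forall i, `[- M, M]%classic (x ord0 i)].
have cA : compact A.
  by apply: (@rV_compact _ _ (fun=> `[- M, M]%classic)) => i; exact: segment_compact.
have out x : ~ A x -> f x = 0.
  apply: contra_notP => fx i; rewrite /= in_itv/= -ler_norml leNgt.
  by apply/negP => /fM.
have [A0|/set0P A0] := eqVneq A set0.
  by exists 0 => x; rewrite out ?normr0// A0.
have cNf : {within A, continuous (fun x => `|f x|)}.
  apply: continuous_subspaceT => x; apply: continuous_comp; first exact: cf.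
  exact: norm_continuous.
have [c _ fc] := compact_EVT_max A0 cA cNf.
exists `|f c| => x; have [Ax|/out ->] := pselect (A x); first by apply: fc; rewrite inE.
by rewrite normr0.
Qed.

(** A box has finite measure and a continuous function supported in it is
    bounded. *)
Lemma integrable_box (R : realType) (n : nat) (f : 'rV[R]_n -> R) (M : R) :
  continuous f -> (forall (x : 'rV[R]_n) i, M < `|x ord0 i| -> f x = 0) ->
  (lebesgue_rV n).-integrable [set: 'rV[measurableTypeR R]_n] (EFin \o f).
Proof.
move=> cf fM; have [C fC] := continuous_box_bounded cf fM.
pose A := [set x : 'rV[measurableTypeR R]_n | forall i, `[- M, M]%classic (x ord0 i)].
have mA : measurable A.
  rewrite (_ : A = \bigcap_(j in [set: 'I_n]) (coord_rV j @^-1` `[- M, M]%classic)).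
    apply: fin_bigcap_measurable => // j _.
    by rewrite -[X in measurable X]setTI; exact: measurable_coord_rV.
  by apply/seteqP; split => [x xA i _|x xA i]; [exact: xA|exact: xA].
have mf := continuous_measurable_rV cf.
apply/integrableP; split; first exact/measurable_EFinP.
rewrite (_ : (fun x => _) = (EFin \o (fun x => `|f x|)) \_ A); last first.
  apply/funext => x /=; rewrite patchE; case: ifPn => //.
  rewrite notin_setE => nAx; suff -> : f x = 0 by rewrite normr0.
  apply: contra_notP nAx => fx i; rewrite /= in_itv/= -ler_norml leNgt.
  by apply/negP => /fM.
rewrite -integral_mkcond.
apply: (@le_lt_trans _ _ (\int[lebesgue_rV n]_(x in A) (cst C%:E) x)%E).
  apply: ge0_le_integral => //.
  - by move=> x _; rewrite /= lee_fin.
  - apply/measurable_EFinP; apply: measurable_funTS; exact: measurableT_comp.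
  - by move=> x _; rewrite lee_fin.
rewrite integral_cst//= /A (@lebesgue_rV_box R n (fun=> `[- M, M]%classic))//.
set P := (\prod_(i < n) _)%E; suff Pfin : P \is a fin_num.
  by rewrite -(fineK Pfin) -EFinM ltry.
rewrite /P; elim/big_ind : _ => // [x y|i _]; first exact: fin_numM.
by rewrite lebesgue_measure_itv/=; case: ifP.
Qed.

(** * Integrals of partial derivatives *)

Lemma integral_derive_eq0 (R : realType) (F G : R -> R) (M : R) :
  continuous G -> (forall t : R, is_derive t (1 : R) F (G t)) ->
  (forall t, M < `|t| -> F t = 0) -> (forall t, M < `|t| -> G t = 0) ->
  (\int[lebesgue_measure]_t (G t)%:E = 0)%E.
Proof.
move=> cG FG F0 G0; pose b := `|M| + 1.
have b0 : 0 < b by rewrite ltr_wpDl.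
have Mb : M < b by rewrite (le_lt_trans (ler_norm M))// ltrDl.
have cF : continuous F.
  by move=> t; apply/differentiable_continuous/derivable1_diffP; exact: ex_derive.
rewrite (_ : (fun t => _) = (EFin \o G) \_ `[- b, b]); last first.
  apply/funext => t /=; rewrite patchE; case: ifPn => //.
  rewrite notin_setE /= in_itv/= -ler_norml => /negP; rewrite -ltNge => bt.
  by rewrite G0// (lt_trans Mb).
rewrite -integral_mkcond (@continuous_FTC2 _ G F).
- by rewrite !F0 ?normrN ?gtr0_norm// -EFinB subrr.
- by rewrite gtrN.
- exact: continuous_subspaceT.
- split.
  + by move=> t _; exact: ex_derive.
  + exact/cvg_at_right_filter/cF.
  + exact/cvg_at_left_filter/cF.
- by move=> t _; rewrite derive1E derive_val.
Qed.

Lemma line_coord (R : pzRingType) (n : nat) (x : 'rV[R]_n) (s : R) (i j : 'I_n) :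
  (x + s *: delta_mx ord0 i) ord0 j = x ord0 j + s * (j == i)%:R.
Proof. by rewrite !mxE. Qed.

Section slices.
Context {R : realType} {n : nat}.
Local Notation T := (measurableTypeR R).

Lemma continuous_row_cons (S : topologicalType) (f : S -> R) (g : S -> 'rV[R]_n) :
  continuous f -> continuous g ->
  continuous (fun s => @row_cons _ T n (f s, g s) : 'rV[R]_n.+1).
Proof.
move=> cf cg s; apply: cvg_coord_rV => j; have [i ->|->] := unliftP ord0 j.
  under eq_fun do rewrite row_cons_lift.
  rewrite row_cons_lift /=.
  apply: (@continuous_comp _ _ _ g (fun x : 'rV[R]_n => x ord0 i)).
    exact: cg.
  exact: coord_continuous.
by under eq_fun do rewrite row_cons0; rewrite row_cons0; exact: cf.
Qed.

Lemma row_cons_addl (t s : R) (y : 'rV[R]_n) :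
  @row_cons _ T n (t, y) + s *: delta_mx ord0 ord0 = @row_cons _ T n (t + s, y)
  :> 'rV[R]_n.+1.
Proof.
apply/rowP => j; rewrite line_coord; have [i ->|->] := unliftP ord0 j.
  by rewrite !row_cons_lift/= mulr0 addr0.
by rewrite !row_cons0/= mulr1.
Qed.

Lemma row_cons_addr (t s : R) (y : 'rV[R]_n) (i : 'I_n) :
  @row_cons _ T n (t, y) + s *: delta_mx ord0 (lift ord0 i) =
  @row_cons _ T n (t, y + s *: delta_mx ord0 i) :> 'rV[R]_n.+1.
Proof.
apply/rowP => j; rewrite line_coord; have [k ->|->] := unliftP ord0 j.
  by rewrite !row_cons_lift/= line_coord (inj_eq lift_inj).
by rewrite !row_cons0/= mulr0 addr0.
Qed.

(** What Fubini's theorem needs in order to be applied to the measure on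
    [R^(n+1)], which is the image of a product measure. *)
Lemma integral_lebesgue_cons (f : 'rV[R]_n.+1 -> \bar R) :
  (lebesgue_rV n.+1).-integrable [set: 'rV[T]_n.+1] f ->
  [/\ ((@lebesgue_measure R \x lebesgue_rV n)%E).-integrable setT (f \o @row_cons _ T n) &
  (\int[lebesgue_rV n.+1]_x f x =
    \int[(@lebesgue_measure R \x lebesgue_rV n)%E]_z (f (@row_cons _ T n z)))%E].
Proof.
move=> /integrableP[mf foo].
have mrc := @measurable_row_cons _ T n.
have mfc : measurable_fun setT (f \o @row_cons _ T n) by exact: measurableT_comp.
have ifc : ((@lebesgue_measure R \x lebesgue_rV n)%E).-integrable setT
    (f \o @row_cons _ T n).
  apply/integrableP; split => //; apply: le_lt_trans foo.
  have := @ge0_integral_pushforward _ _ _ _ R _ mrc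
    (@lebesgue_measure R \x lebesgue_rV n)%E setT (fun x => `|f x|)%E measurableT.
  rewrite preimage_setT => <-//; first exact: measurableT_comp.

split=> //.
rewrite (@eq_measure_integral _ _ _ setT
  (pushforward (@lebesgue_measure R \x lebesgue_rV n)%E (@row_cons _ T n)))//.
by rewrite integral_pushforward.
Qed.
End slices.

(** The derivative is taken along lines, as a derivative of a function of one
    real variable, so that slicing by [row_cons] preserves the hypotheses and
    the one-variable chain rule serves to verify them. In the induction, if [j]
    is the first coordinate the inner integral vanishes by the fundamental
    theorem of calculus, and otherwise by the induction hypothesis. *)
Lemma integral_partial_eq0 (R : realType) (n : nat) (j : 'I_n)
    (F G : 'rV[R]_n -> R) (M : R) :
  continuous G ->
  (forall x, is_derive (0 : R) (1 : R) (fun s => F (x + s *: delta_mx ord0 j)) (G x)) ->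
  (forall (x : 'rV[R]_n) i, M < `|x ord0 i| -> F x = 0) ->
  (forall (x : 'rV[R]_n) i, M < `|x ord0 i| -> G x = 0) ->
  (\int[lebesgue_rV n]_x (G x)%:E = 0)%E.
Proof.
elim: n j F G => [[]//|n IHn] j F G cG FG F0 G0.
have iG := integrable_box cG G0.
have [iGc ->] := integral_lebesgue_cons iG.
have [i ji|j0] := unliftP ord0 j.
- rewrite -(fubini1 iGc); rewrite -[RHS](integral0 (@lebesgue_measure R) setT).
  apply: eq_integral => t _; rewrite /fubini_F/=.
  apply: (IHn i (fun y => F (@row_cons _ (measurableTypeR R) n (t, y)))
                (fun y => G (@row_cons _ (measurableTypeR R) n (t, y)))).
  + move=> y; apply: (@continuous_comp _ _ _ (fun y : 'rV[R]_n =>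
      @row_cons _ (measurableTypeR R) n (t, y) : 'rV[R]_n.+1) G); last exact: cG.
    apply: (@continuous_row_cons _ _ _ (fun=> t) id) ; first exact: cst_continuous.
    by move=> ?; apply: cvg_id.
  + move=> y; have := FG (@row_cons _ (measurableTypeR R) n (t, y)).
    by rewrite ji; under eq_fun do rewrite row_cons_addr.
  + by move=> y k Mk; apply: (F0 _ (lift ord0 k)); rewrite row_cons_lift.
  + by move=> y k Mk; apply: (G0 _ (lift ord0 k)); rewrite row_cons_lift.
- rewrite -(fubini2 iGc); rewrite -[RHS](integral0 (lebesgue_rV n) setT).
  apply: eq_integral => y _; rewrite /fubini_G/=.
  apply: (@integral_derive_eq0 R
    (fun t => F (@row_cons _ (measurableTypeR R) n (t, y)))
    (fun t => G (@row_cons _ (measurableTypeR R) n (t, y))) M).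
  + move=> t; apply: (@continuous_comp _ _ _ (fun t : R =>
      @row_cons _ (measurableTypeR R) n (t, y) : 'rV[R]_n.+1) G); last exact: cG.
    apply: (@continuous_row_cons _ _ _ id (fun=> y)) ; first by move=> ?; apply: cvg_id.
    exact: cst_continuous.
  + move=> t; have := FG (@row_cons _ (measurableTypeR R) n (t, y)).
    rewrite j0; under eq_fun do rewrite row_cons_addl.
    move=> H.
    have H1 : is_derive t (1 : R) (fun s : R => s - t) 1.
      by have := @is_derive_shift _ t (1 : R) (- t).
    rewrite -[G _]mulr1.
    rewrite (_ : (fun t0 => _) = (fun s => F (@row_cons _ (measurableTypeR R) n
       (t + s, y))) \o (fun s => s - t)); last first.
      by apply/funext => s /=; rewrite addrC subrK.
    by apply: is_derive1_comp => //; rewrite subrr.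
  + by move=> t Mk; apply: (F0 _ ord0); rewrite row_cons0.
  + by move=> t Mk; apply: (G0 _ ord0); rewrite row_cons0.
Qed.

(** * Powers, pointwise calculus and inequalities *)

(** The real power [y `^ r] equals 1 for [y < 0], hence the absolute value,
    which makes the function continuous, and differentiable for [r > 1],
    through 0. *)
Lemma powR_norm_continuous (R : realType) (r : R) : 0 < r ->
  continuous (fun y : R => `|y| `^ r).
Proof.
move=> r0 y; have [->|y0] := eqVneq y 0.
  apply/cvgrPdist_lt => /= e e0; rewrite normr0 powR0 ?gt_eqF//.
  have := @nbhs0_lt R R^o (e `^ r^-1) (powR_gt0 _ e0); apply: filterS => z ze.
  rewrite sub0r normrN ger0_norm ?powR_ge0//.
  rewrite -[ltRHS](@powRr1 _ e) ?(ltW e0)// -(mulVf (lt0r_neq0 r0)) powRrM.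
  apply: gt0_ltr_powR => //; rewrite ?nnegrE ?powR_ge0//.
apply: (@continuous_comp _ _ _ (fun y : R => `|y|) (fun z => z `^ r)).
  exact: norm_continuous.
apply/differentiable_continuous/derivable1_diffP; apply: derivable_powR.
by rewrite in_itv/= andbT normr_gt0.
Qed.

Lemma is_derive_powR_norm (R : realType) (r y : R) : 1 < r -> 0 <= y ->
  is_derive y (1 : R) (fun z : R => `|z| `^ r) (r * y `^ (r - 1)).
Proof.
move=> r1; rewrite le_eqVlt => /predU1P[<-|y0]; last first.
  apply: (@near_eq_is_derive _ _ _ (fun z => z `^ r)); last exact: is_derive1_powR.
  by near=> z; rewrite gtr0_norm//; near: z; exact: lt_nbhsr.
have r10 : 0 < r - 1 by rewrite subr_gt0.
rewrite powR0 ?gt_eqF// mulr0; apply/is_derive1_caratheodory.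
exists (fun z => Num.sg z * `|z| `^ (r - 1)); split.
- move=> z; rewrite normr0 powR0 ?gt_eqF ?(lt_trans _ r1)// !subr0.
  by rewrite mulrAC mulrC -normrEsg mulrC mulr_powRB1// (lt_trans _ r1).
- apply/cvgrPdist_le => /= e e0; rewrite sgr0 mul0r.
  have := @powR_norm_continuous R (r - 1) r10 0.
  move=> /cvgrPdist_le /(_ e e0); rewrite normr0 powR0 ?gt_eqF//=.
  apply: filterS => z; rewrite !sub0r !normrN normrM; apply: le_trans.
  by rewrite ler_piMl// normr_sg lern1 leq_b1.
- by rewrite sgr0 mul0r.
Unshelve. all: by end_near. Qed.

Lemma is_derive_line (R : realType) (n : nat) (f : 'rV[R]_n -> R) (x v : 'rV[R]_n) :
  derivable f x v ->
  is_derive (0 : R) (1 : R) (fun s => f (x + s *: v)) ('D_v f x).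
Proof.
move=> fxv.
have E : (fun h : R => h^-1 *: (((fun s => f (x + s *: v)) \o shift 0) (h *: 1)
     - f (x + 0 *: v))) = (fun h => h^-1 *: ((f \o shift x) (h *: v) - f x)).
  apply/funext => h /=.
  by rewrite addr0 scale0r addr0 [h *: 1]mulr1 [x + _]addrC.
by split; rewrite /derivable /derive E.
Qed.

(** Valid for infinite integrals too, with the convention [0 * oo = 0]: if one
    of the factors vanishes, so does the product almost everywhere. *)
Lemma cauchy_schwarz_integral d (T : measurableType d) (R : realType)
    (mu : {measure set T -> \bar R}) (a b : T -> R) :
  measurable_fun setT a -> measurable_fun setT b ->
  (forall x, 0 <= a x) -> (forall x, 0 <= b x) ->
  ((\int[mu]_x (a x * b x)%:E) ^+ 2 <=
   (\int[mu]_x (a x ^+ 2)%:E) * (\int[mu]_x (b x ^+ 2)%:E))%E.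
Proof.
move=> ma mb a0 b0.
have sq (x : \bar R) : (0 <= x)%E -> (x ^+ 2 = x `^ 2)%E.
  rewrite expe2; case: x => [x x0| _|//]; last by rewrite poweRyr ?mulyy ?pnatr_eq0.
  by rewrite poweR_EFin -EFinM powR_mulrn// expr2.
have normsq (c : T -> R) : ('N[mu]_2%:E[EFin \o c] ^+ 2 = \int[mu]_x (c x ^+ 2)%:E)%E.
  rewrite sq ?Lnorm_ge0// poweR_Lnorm ?pnatr_eq0//; apply: eq_integral => x _ /=.
  by rewrite powR_mulrn// real_normK ?num_real.
rewrite -!normsq.
have h2 : 0 < 2 :> R by rewrite ltr0n.
have hh : 2^-1 + 2^-1 = 1 :> R by rewrite [RHS](splitr 1) mul1r.
have := @hoelder _ _ _ mu a b 2 2 ma mb h2 h2 hh.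
rewrite Lnorm1 (eq_integral (fun x => (a x * b x)%:E)); last first.
  by move=> x _; rewrite /= ger0_norm// mulr_ge0.
have i0 : (0 <= \int[mu]_x (a x * b x)%:E)%E.
  by apply: integral_ge0 => x _; rewrite lee_fin mulr_ge0.
move=> H; rewrite !expe2 muleACA.
by apply: lee_pmul.
Qed.

Lemma continuous_powR_ge0 (R : realType) (T : topologicalType) (f : T -> R) (r : R) :
  0 < r -> (forall x, 0 <= f x) -> continuous f -> continuous (fun x => f x `^ r).
Proof.
move=> r0 f0 cf; rewrite (_ : (fun x => _) = (fun y => `|y| `^ r) \o f).
  move=> x; apply: continuous_comp; first exact: cf.
  exact: powR_norm_continuous.
by apply/funext => x /=; rewrite ger0_norm.
Qed.

Lemma continuous_powR_gt0 (R : realType) (T : topologicalType) (f : T -> R) (r : R) :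
  (forall x, 0 < f x) -> continuous f -> continuous (fun x => f x `^ r).
Proof.
move=> f0 cf x; apply: (@continuous_comp _ _ _ f (fun z => z `^ r)); first exact: cf.
apply/differentiable_continuous/derivable1_diffP; apply: derivable_powR.
by rewrite in_itv/= andbT.
Qed.

Section continuous_pointwise.
Context {R : realType} {T : topologicalType}.
Implicit Types f g : T -> R.

Lemma continuous_addr f g : continuous f -> continuous g ->
  continuous (fun x => f x + g x).
Proof. by move=> cf cg x; apply: continuousD; [exact: cf|exact: cg]. Qed.

Lemma continuous_subr f g : continuous f -> continuous g ->
  continuous (fun x => f x - g x).
Proof. by move=> cf cg x; apply: continuousB; [exact: cf|exact: cg]. Qed.

Lemma continuous_mulr f g : continuous f -> continuous g ->
  continuous (fun x => f x * g x).
Proof. by move=> cf cg x; apply: continuousM; [exact: cf|exact: cg]. Qed.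

Lemma continuous_sqr f : continuous f -> continuous (fun x => f x ^+ 2).
Proof.
move=> cf; rewrite (_ : (fun x => _) = (fun x => f x * f x)).
  exact: continuous_mulr.
by apply/funext => x; rewrite expr2.
Qed.

Lemma continuous_normr f : continuous f -> continuous (fun x => `|f x|).
Proof.
by move=> cf x; apply: continuous_comp; [exact: cf|exact: norm_continuous].
Qed.

Lemma continuous_sum n (f : 'I_n -> T -> R) : (forall j, continuous (f j)) ->
  continuous (fun x => \sum_j f j x).
Proof. by move=> cf; apply: continuous_big => //; exact: add_continuous. Qed.

End continuous_pointwise.

Lemma cauchy_schwarz_sum (R : realType) (n : nat) (x y : 'I_n -> R) :
  `|\sum_j x j * y j| <= Num.sqrt (\sum_j x j ^+ 2) * Num.sqrt (\sum_j y j ^+ 2).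
Proof.
set X := \sum_j x j ^+ 2; set Y := \sum_j y j ^+ 2; set Z := \sum_j x j * y j.
have X0 : 0 <= X by apply: sumr_ge0 => j _; exact: sqr_ge0.
have Y0 : 0 <= Y by apply: sumr_ge0 => j _; exact: sqr_ge0.
rewrite -sqrtrM// -sqrtr_sqr ler_wsqrtr//.
move: (Y0); rewrite le_eqVlt => /predU1P[/esym/eqP YE|Yp].
  rewrite psumr_eq0 in YE; last by move=> j _; exact: sqr_ge0.
  rewrite /Z big1 ?expr0n ?mulr_ge0// => j _.
  move/allP : YE => /(_ j); rewrite mem_index_enum sqrf_eq0 => /(_ isT)/eqP ->.
  by rewrite mulr0.
(* The vector [Y x - Z y] is [Y] times the component of [x] orthogonal to [y]. *)
have : 0 <= \sum_j (Y * x j - Z * y j) ^+ 2 by apply: sumr_ge0 => j _; exact: sqr_ge0.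
rewrite (_ : \sum_j _ = Y * (X * Y - Z ^+ 2)); first by rewrite pmulr_rge0// subr_ge0.
transitivity (\sum_j (Y ^+ 2 * x j ^+ 2 +
    (- 2 * Y * Z * (x j * y j) + Z ^+ 2 * y j ^+ 2))).
  by apply: eq_bigr => j _; ring.
by rewrite !big_split/= -!mulr_sumr -/X -/Y -/Z; ring.
Qed.

Lemma measurable_powR_rV (R : realType) (n : nat) (f : 'rV[R]_n -> R) (r : R) :
  continuous f ->
  measurable_fun [set: 'rV[measurableTypeR R]_n] (fun x => f x `^ r).
Proof.
move=> cf; apply: (measurableT_comp (measurable_powR r)).
exact: continuous_measurable_rV.
Qed.

Lemma measurable_sqrt_rV (R : realType) (n : nat) (f : 'rV[R]_n -> R) :
  continuous f ->
  measurable_fun [set: 'rV[measurableTypeR R]_n] (fun x => Num.sqrt (f x)).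
Proof.
move=> cf; apply: continuous_measurable_rV => x.
by apply: continuous_comp; [exact: cf|exact: sqrt_continuous].
Qed.

Section limn_einf_bounds.
Context {R : realType}.
Local Open Scope ereal_scope.

Lemma ge_limn_einf (f : (\bar R)^nat) (c : \bar R) :
  (forall k, c <= f k) -> c <= limn_einf f.
Proof.
move=> cf; rewrite limn_einf_lim; apply: lime_ge; first exact: is_cvg_einfs.
by apply: nearW => k; apply: le_ereal_inf_tmp => _ [m /= _ <-].
Qed.

Lemma le_limn_einf (f : (\bar R)^nat) (c : \bar R) :
  (forall k, f k <= c) -> limn_einf f <= c.
Proof.
move=> fc; rewrite limn_einf_lim; apply: lime_le; first exact: is_cvg_einfs.
by apply: nearW => k; apply: le_trans (fc k); apply: ereal_inf_lbound; exists k => /=.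
Qed.

End limn_einf_bounds.

(** * The weighted Hardy inequality *)

Section weighted_hardy.
Context {R : realType} {n : nat}.
Variables (p q : R) (u v : 'rV[R]_n -> R) (U V : 'I_n -> 'rV[R]_n -> R) (M : R).
Hypotheses (cu : continuous u) (cv : continuous v).
Hypotheses (cU : forall j, continuous (U j)) (cV : forall j, continuous (V j)).
Hypothesis dU : forall j x,
  is_derive (0 : R) (1 : R) (fun s => u (x + s *: delta_mx ord0 j)) (U j x).
Hypothesis dV : forall j x,
  is_derive (0 : R) (1 : R) (fun s => v (x + s *: delta_mx ord0 j)) (V j x).
Hypothesis u0 : forall (x : 'rV[R]_n) i, M < `|x ord0 i| -> u x = 0.
Hypothesis v0 : forall (x : 'rV[R]_n) i, M < `|x ord0 i| -> v x = 0.
Hypotheses (p2 : 2 < p) (q0 : 0 < q).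

Let r2 x := u x ^+ 2 + v x ^+ 2.
Let Q (x : 'rV[R]_n) := \sum_j x ord0 j ^+ 2.
(* Half the gradient of [r2]. *)
Let S j x := u x * U j x + v x * V j x.

Let r20 x : 0 <= r2 x. Proof. by rewrite addr_ge0 ?sqr_ge0. Qed.
Let Q0 x : 0 <= Q x. Proof. by rewrite sumr_ge0// => j _; exact: sqr_ge0. Qed.

Let p2gt1 : 1 < p / 2. Proof. by rewrite ltr_pdivlMr// mul1r. Qed.
Let p20 : 0 < p / 2 - 1. Proof. by rewrite subr_gt0. Qed.
Let p0 : 0 < p. Proof. by rewrite (lt_trans _ p2). Qed.

Let ccoord j : continuous (fun x : 'rV[R]_n => x ord0 j).
Proof. exact: coord_continuous. Qed.

Let cr2 : continuous r2.
Proof. by apply: continuous_addr; exact: continuous_sqr. Qed.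

Let cS j : continuous (S j).
Proof. by apply: continuous_addr; exact: continuous_mulr. Qed.

Let cQ : continuous Q.
Proof. by apply: continuous_sum => j; exact: continuous_sqr. Qed.

Let ch : continuous (fun x => r2 x `^ (p / 2)).
Proof. by apply: continuous_powR_ge0 => //; rewrite (lt_trans _ p2gt1). Qed.

Let ch1 : continuous (fun x => r2 x `^ (p / 2 - 1)).
Proof. exact: continuous_powR_ge0. Qed.

Section regularization.
Variable e : R.
Hypothesis e0 : 0 < e.

Let w x := (Q x + e) `^ (- (q / 2)).
(* The partial derivative along [j] of [r2^(p/2) * x_j * w]. *)
Let psi j x := p * r2 x `^ (p / 2 - 1) * S j x * (x ord0 j * w x) +
  r2 x `^ (p / 2) * (w x - q * x ord0 j ^+ 2 * (Q x + e) `^ (- (q / 2) - 1)).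

Let Qe0 x : 0 < Q x + e. Proof. by rewrite ltr_wpDl. Qed.

Let cQe : continuous (fun x => Q x + e).
Proof. by apply: continuous_addr => //; exact: cst_continuous. Qed.

Let cw : continuous w.
Proof. exact: continuous_powR_gt0. Qed.

Let cpsi j : continuous (psi j).
Proof.
apply: continuous_addr; apply: continuous_mulr => //.
- apply: continuous_mulr => //; apply: continuous_mulr => //.
  exact: cst_continuous.
- exact: continuous_mulr.
- apply: continuous_subr => //; apply: continuous_mulr.
    by apply: continuous_mulr; [exact: cst_continuous|exact: continuous_sqr].
  exact: continuous_powR_gt0.
Qed.

Let dpsi j x : is_derive (0 : R) (1 : R)
  (fun s => r2 (x + s *: delta_mx ord0 j) `^ (p / 2) *
    ((x + s *: delta_mx ord0 j) ord0 j * w (x + s *: delta_mx ord0 j))) (psi j x).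
Proof.
pose L (f : 'rV[R]_n -> R) s := f (x + s *: delta_mx ord0 j).
have L0 (f : 'rV[R]_n -> R) : L f 0 = f x by rewrite /L scale0r addr0.
have dr2 : is_derive (0 : R) (1 : R) (L r2) (2 * S j x).
  have H : is_derive (0 : R) (1 : R) (L r2) _ :=
    is_deriveD (is_deriveX 2 (dU j x)) (is_deriveX 2 (dV j x)).
  apply: (is_derive_eq H); rewrite scale0r addr0 !expr1.
  rewrite /S; move: (u x) (v x) (U j x) (V j x) => a b c d.
  by rewrite -[_ *: c]/(_ * c) -[_ *: d]/(_ * d); ring.
have dh : is_derive (0 : R) (1 : R) (L (fun x => r2 x `^ (p / 2)))
    (p * r2 x `^ (p / 2 - 1) * S j x).
  have d1 := @is_derive_powR_norm R (p / 2) (L r2 0) p2gt1 (r20 _).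
  have := @is_derive1_comp _ _ _ _ _ _ d1 dr2.
  rewrite (_ : _ \o _ = (L (fun x => r2 x `^ (p / 2)))); last first.
    by apply/funext => s /=; rewrite /L ger0_norm.
  by move=> H; apply: (is_derive_eq H); rewrite L0; field.
have dc k : is_derive (0 : R) (1 : R) (L (fun x => x ord0 k)) (k == j)%:R.
  rewrite (_ : L _ = (fun s => x ord0 k + s * (k == j)%:R)); last first.
    by apply/funext => s; rewrite /L line_coord.
  have H : is_derive (0 : R) (1 : R) (fun s => x ord0 k + s * (k == j)%:R) _ :=
    is_deriveD (is_derive_cst (x ord0 k) (0 : R) (1 : R))
     (is_deriveM (is_derive_id (0 : R) (1 : R))
       (is_derive_cst ((k == j)%:R : R) (0 : R) (1 : R))).
  by apply: (is_derive_eq H); rewrite scaler0 !add0r /GRing.scale/= mulr1.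
have dQ : is_derive (0 : R) (1 : R) (L (fun x => Q x + e)) (2 * x ord0 j).
  have := is_deriveD (is_derive_sum (fun k => is_deriveX 2 (dc k)))
    (is_derive_cst e (0 : R) (1 : R)).
  rewrite (_ : _ + cst e = (L (fun x => Q x + e))); last first.
    by apply/funext => s; rewrite /L/= fct_sumE.
  move=> H; apply: (is_derive_eq H); rewrite addr0 (bigD1 j)//= big1 ?addr0.
    by rewrite eqxx L0 expr1 /GRing.scale/= mulr1 mulr_natl.
  by move=> k /negbTE ->; rewrite scaler0.
have dw : is_derive (0 : R) (1 : R) (L w)
    (- (q * x ord0 j * (Q x + e) `^ (- (q / 2) - 1))).
  have d1 := @is_derive1_powR R (- (q / 2)) (L (fun x => Q x + e) 0) (Qe0 _).
  have := @is_derive1_comp _ _ _ _ _ _ d1 dQ.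
  by move=> H; apply: (is_derive_eq H); rewrite L0; field.
apply: (is_derive_eq (is_deriveM dh (is_deriveM (dc j) dw))).
rewrite -[(L _ * L w) 0]/(L _ 0 * L w 0) !L0 /psi eqxx.
move: (_ `^ (p / 2)) (_ `^ (p / 2 - 1)) (_ `^ (- (q / 2) - 1)) (w x) (S j x).
move: (x ord0 j) => a b c d f g.
rewrite -[a *: _]/(a * _) -[f *: _]/(f * _) -[(a * f) *: _]/(a * f * _).
by rewrite -[b *: _]/(b * _) mulr1n; ring.
Qed.

Let W1Q x : (Q x + e) `^ (- (q / 2) - 1) * (Q x + e) = w x.
Proof.
rewrite /w -[X in _ * X](@powRr1 _ (Q x + e)) ?(ltW (Qe0 x))// -powRD ?subrK//.
by rewrite (gt_eqF (Qe0 x)) implybT.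
Qed.

Let r2_0 (x : 'rV[R]_n) i : M < `|x ord0 i| -> r2 x = 0.
Proof. by move=> Mx; rewrite /r2 (u0 Mx) (v0 Mx) expr0n addr0. Qed.

Let h_0 (x : 'rV[R]_n) i : M < `|x ord0 i| -> r2 x `^ (p / 2) = 0.
Proof. by move=> Mx; rewrite (r2_0 Mx) powR0// gt_eqF// (lt_trans _ p2gt1). Qed.

Let h1_0 (x : 'rV[R]_n) i : M < `|x ord0 i| -> r2 x `^ (p / 2 - 1) = 0.
Proof. by move=> Mx; rewrite (r2_0 Mx) powR0// gt_eqF. Qed.

Let psi_0 j (x : 'rV[R]_n) i : M < `|x ord0 i| -> psi j x = 0.
Proof. by move=> Mx; rewrite /psi (h_0 Mx) (h1_0 Mx) !(mulr0, mul0r) addr0. Qed.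

Let integral_psi j : (\int[lebesgue_rV n]_x (psi j x)%:E = 0)%E.
Proof.
apply: (@integral_partial_eq0 _ _ j (fun x => r2 x `^ (p / 2) * (x ord0 j * w x))
  (psi j) M (@cpsi j) (@dpsi j)) => x i Mx; last exact: psi_0 Mx.
by rewrite (h_0 Mx) mul0r.
Qed.

Let sum_psi x : \sum_j psi j x =
  p * r2 x `^ (p / 2 - 1) * w x * (\sum_j x ord0 j * S j x) +
  r2 x `^ (p / 2) * (n%:R * w x - q * Q x * (Q x + e) `^ (- (q / 2) - 1)).
Proof.
rewrite big_split/= -[X in _ + X]mulr_sumr; congr (_ + _ * _).
  by rewrite mulr_sumr; apply: eq_bigr => j _; ring.
by rewrite sumrB sumr_const card_ord -(mulr_natl (w x) n) -mulr_suml -mulr_sumr.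
Qed.

Let K x := r2 x `^ (p / 2 - 1) * w x * `|\sum_j x ord0 j * S j x|.

(* The field [x * w] has divergence at least [(n - q) * w]: this is where the
   sign of [q] matters. *)
Let pointwise x :
  (n%:R - q) / p * (r2 x `^ (p / 2) * w x) <= p^-1 * (\sum_j psi j x) + K x.
Proof.
have QW : Q x * (Q x + e) `^ (- (q / 2) - 1) <= w x.
  by rewrite -W1Q [leLHS]mulrC ler_wpM2l ?powR_ge0// lerDl ltW.
have := ler_norm (- \sum_j x ord0 j * S j x); rewrite normrN => Zle.
rewrite -(ler_pM2l p0) mulrDr mulVKf ?gt_eqF// sum_psi /K.
set Z := \sum_j _ in Zle *.
set h := r2 x `^ (p / 2); set h1 := r2 x `^ (p / 2 - 1).
have h0 : 0 <= h by exact: powR_ge0.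
have hw : 0 <= p * (h1 * w x).
  by rewrite mulr_ge0 ?(ltW p0)// mulr_ge0 ?powR_ge0.
have := ler_wpM2l hw Zle; have := ler_wpM2l (mulr_ge0 (ltW q0) h0) QW.
rewrite (_ : p * (_ / p * _) = (n%:R - q) * (h * w x)); last first.
  by field; rewrite gt_eqF.
clear hw h0 Zle QW; clearbody Z h h1.
move: (n%:R : R) => N. move: `|Z| => Z'. move: (w x) => w'.
move: (Q x) => Q'. move: (_ `^ _) => W H1 H2.
lra.
Qed.

Let cK : continuous K.
Proof.
apply: continuous_mulr; first exact: continuous_mulr.
by apply: continuous_normr; apply: continuous_sum => j; exact: continuous_mulr.
Qed.

(** The absolute value comes from bounding the inner product of the field with
    the gradient of [|f|^p], and the boundary terms vanish by
    [integral_partial_eq0]. *)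
Lemma hardy_regularized :
  (\int[lebesgue_rV n]_x ((n%:R - q) / p *
     ((u x ^+ 2 + v x ^+ 2) `^ (p / 2) *
      (\sum_j x ord0 j ^+ 2 + e) `^ (- (q / 2))))%:E
   <= \int[lebesgue_rV n]_x ((u x ^+ 2 + v x ^+ 2) `^ (p / 2 - 1) *
        (\sum_j x ord0 j ^+ 2 + e) `^ (- (q / 2)) *
        `|\sum_j x ord0 j * (u x * U j x + v x * V j x)|)%:E)%E.
Proof.
pose A x := (n%:R - q) / p * (r2 x `^ (p / 2) * w x).
pose P x := p^-1 * (\sum_j psi j x).
have iA : (lebesgue_rV n).-integrable [set: 'rV[measurableTypeR R]_n] (EFin \o A).
  apply: (@integrable_box _ _ _ M) => [|x i Mx].
    apply: continuous_mulr; first exact: cst_continuous.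
    exact: continuous_mulr.
  by rewrite /A (h_0 Mx) mul0r mulr0.
have iK : (lebesgue_rV n).-integrable [set: 'rV[measurableTypeR R]_n] (EFin \o K).
  apply: (@integrable_box _ _ _ M) => // x i Mx.
  by rewrite /K (h1_0 Mx) !mul0r.
have ipsi j : (lebesgue_rV n).-integrable [set: 'rV[measurableTypeR R]_n] (EFin \o psi j).
  by apply: (@integrable_box _ _ _ M) => // x i Mx; exact: psi_0 Mx.
have iP : (lebesgue_rV n).-integrable [set: 'rV[measurableTypeR R]_n] (EFin \o P).
  apply: (@integrable_box _ _ _ M) => [|x i Mx].
    apply: continuous_mulr; first exact: cst_continuous.
    exact: continuous_sum.
  by rewrite /P big1 ?mulr0// => j _; exact: psi_0 Mx.
have P0 : (\int[lebesgue_rV n]_x (P x)%:E = 0)%E.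
  under eq_integral do rewrite /P EFinM -sumEFin.
  rewrite integralZl//; last by apply: integrable_sum => // j _; exact: ipsi.
  have -> : (\int[lebesgue_rV n]_x (\sum_j (psi j x)%:E)%R = 0)%E; last by rewrite mule0.
  rewrite (integral_sum measurableT ipsi) big1// => j _; exact: integral_psi.
apply: (@le_trans _ _ (\int[lebesgue_rV n]_x ((P x)%:E + (K x)%:E))%E).
  apply: le_integral => //; first exact: integrableD.
  by move=> x _; rewrite -EFinD lee_fin; exact: pointwise.
by rewrite integralD// P0 add0e.
Qed.

End regularization.

Hypothesis qn : q < n%:R.

Let cS2 : continuous (fun x => \sum_j S j x ^+ 2).
Proof.
apply: continuous_sum => j; apply: continuous_sqr.
by apply: continuous_addr; exact: continuous_mulr.
Qed.

Let G x := r2 x `^ (p / 2 - 1) * Num.sqrt (\sum_j S j x ^+ 2) * Q x `^ ((1 - q) / 2).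

Let mG : measurable_fun [set: 'rV[measurableTypeR R]_n] G.
Proof.
apply: measurable_funM; last exact: measurable_powR_rV.
apply: measurable_funM; first exact: measurable_powR_rV.
exact: measurable_sqrt_rV.
Qed.

Let weight_le e x : 0 < e ->
  Num.sqrt (Q x) * (Q x + e) `^ (- (q / 2)) <= Q x `^ ((1 - q) / 2).
Proof.
move=> e0; have [Qx0|Qx0] := eqVneq (Q x) 0.
  by rewrite Qx0 sqrtr0 mul0r powR_ge0.
have Qp : 0 < Q x by rewrite lt0r Qx0 Q0.
rewrite -powR12_sqrt// mulrBl mul1r powRD ?Qx0 ?implybT// ler_wpM2l ?powR_ge0//.
rewrite !powRN lef_pV2 ?posrE ?powR_gt0// ?ltr_wpDl//.
by apply: ge0_ler_powR; rewrite ?nnegrE ?addr_ge0 ?lerDl ?divr_ge0 ?ltW.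
Qed.

Let regularized_le e : 0 < e ->
  (\int[lebesgue_rV n]_x ((n%:R - q) / p *
     (r2 x `^ (p / 2) * (Q x + e) `^ (- (q / 2))))%:E
   <= \int[lebesgue_rV n]_x (G x)%:E)%E.
Proof.
move=> e0.
apply: (le_trans (hardy_regularized e0)).
apply: ge0_le_integral => //.
- by move=> x _; rewrite lee_fin !mulr_ge0 ?powR_ge0.
- apply/measurable_EFinP; apply: measurable_funM.
    apply: measurable_funM; apply: measurable_powR_rV => //.
    by apply: continuous_addr => //; exact: cst_continuous.
  apply: continuous_measurable_rV; apply: continuous_normr.
  apply: continuous_sum => j; apply: continuous_mulr; first exact: coord_continuous.
  by apply: continuous_addr; exact: continuous_mulr.
- exact/measurable_EFinP.
- move=> x _; rewrite lee_fin /G -!mulrA ler_wpM2l ?powR_ge0//.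
  have := @cauchy_schwarz_sum R n (fun j => x ord0 j) (S ^~ x).
  rewrite -/(Q x) => /(ler_wpM2l (powR_ge0 (Q x + e) (- (q / 2)))) /le_trans; apply.
  by rewrite mulrA mulrC [X in _ * X]mulrC ler_wpM2l ?sqrtr_ge0// weight_le.
Qed.

(** Fatou's lemma gives the inequality in the form needed: at the origin the
    regularized weight blows up, while the limiting weight takes the value 0
    there, so the latter is only bounded by the lower limit. *)
Lemma hardy_weighted :
  (((n%:R - q) / p)%:E * \int[lebesgue_rV n]_x
     ((u x ^+ 2 + v x ^+ 2) `^ (p / 2) * (\sum_j x ord0 j ^+ 2) `^ (- (q / 2)))%:E
   <= \int[lebesgue_rV n]_x ((u x ^+ 2 + v x ^+ 2) `^ (p / 2 - 1) *
        Num.sqrt (\sum_j (u x * U j x + v x * V j x) ^+ 2) *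
        (\sum_j x ord0 j ^+ 2) `^ ((1 - q) / 2))%:E)%E.
Proof.
have c0 : 0 <= (n%:R - q) / p by rewrite divr_ge0 ?subr_ge0 ?ltW.
rewrite -ge0_integralZl_EFin//; last 2 first.
- by move=> x _; rewrite lee_fin mulr_ge0 ?powR_ge0.
- by apply/measurable_EFinP; apply: measurable_funM; exact: measurable_powR_rV.
pose F k x := ((n%:R - q) / p * (r2 x `^ (p / 2) * (Q x + k.+1%:R^-1) `^ (- (q / 2)))).
have F0 k x : 0 <= F k x by rewrite mulr_ge0// mulr_ge0 ?powR_ge0.
have mF k : measurable_fun [set: 'rV[measurableTypeR R]_n] (EFin \o F k).
  apply/measurable_EFinP; apply: measurable_funM => //.
  apply: measurable_funM; apply: measurable_powR_rV => //.
  by apply: continuous_addr => //; exact: cst_continuous.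
apply: (@le_trans _ _ (\int[lebesgue_rV n]_x (limn_einf (fun k => (F k x)%:E)))%E).
  apply: ge0_le_integral => //.
  - by move=> x _; rewrite mule_ge0 ?lee_fin// mulr_ge0 ?powR_ge0.
  - apply/measurable_EFinP; apply: measurable_funM => //.
    by apply: measurable_funM; exact: measurable_powR_rV.
  - apply: (@emeasurable_fun_cvg _ _ _ _ (fun m x => einfs (fun k => (F k x)%:E) m)).
      exact: measurable_fun_einfs.
    by move=> x _; rewrite limn_einf_lim; exact: is_cvg_einfs.
  - move=> x _; rewrite -EFinM; have [Qx0|Qx0] := eqVneq (Q x) 0.
      rewrite -/(Q x) Qx0 powR0 ?oppr_eq0 ?gt_eqF ?divr_gt0// !mulr0.
      by apply: ge_limn_einf => k; rewrite lee_fin.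
    have Qp : 0 < Q x by rewrite lt0r Qx0 Q0.
    suff Fx : (fun k => (F k x)%:E) @ \oo -->
        ((n%:R - q) / p * (r2 x `^ (p / 2) * Q x `^ (- (q / 2))))%:E.
      by rewrite (cvg_limn_einf_sup Fx).1.
    apply: cvg_EFin; first exact: nearW.
    apply: cvgMl_tmp; apply: cvgMl_tmp.
    apply: (@cvg_comp _ _ _ (fun k => Q x + k.+1%:R^-1)
      (fun z => z `^ (- (q / 2))) _ (nbhs (Q x))).
      have := @cvgD _ R^o _ \oo _ _ _ _ _ (cvg_cst (Q x)) (@cvg_harmonic R).
      by rewrite addr0 => H; exact: H.
    suff : {for Q x, continuous (fun z : R => z `^ (- (q / 2)))} by [].
    apply/differentiable_continuous/derivable1_diffP; apply: derivable_powR.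
    by rewrite in_itv/= andbT.
apply: le_trans (fatou _ measurableT mF _) _; first by move=> k x _; rewrite lee_fin.
apply: le_limn_einf => k; apply: regularized_le.
by rewrite invr_gt0.
Qed.

End weighted_hardy.

(** * Splitting the gradient into modulus and phase *)

Lemma compact_support_box (R : realType) (n : nat) (g : 'rV[R]_n -> R) :
  compact (closure [set x | g x != 0]) ->
  exists M : R, forall (x : 'rV[R]_n) i, M < `|x ord0 i| -> g x = 0.
Proof.
move=> /compact_bounded[M [_ Mg]]; exists (M + 1) => x i Mx.
apply/eqP; apply: contraTT Mx => gx; rewrite -leNgt.
have : `|x| <= M + 1 by apply: Mg; [rewrite ltrDl|exact: subset_closure].
apply: le_trans; rewrite [leRHS]/Num.Def.normr/= mx_normrE.
exact: (le_bigmax _ (fun ij => `|x ij.1 ij.2|) (ord0, i)).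
Qed.

Lemma powR_sqrt (R : realType) (y r : R) : 0 <= y -> Num.sqrt y `^ r = y `^ (r / 2).
Proof. by move=> y0; rewrite -powR12_sqrt// -powRrM mulrC. Qed.

(** Here [T / r2] is the phase derivative, and [S / sqrt r2], with the [S] of the
    proof, is the gradient of the modulus. Negative powers of [r2], which are 0 where [r2] is, replace the
    quotients: they are measurable, and the pointwise relations of the proof
    then hold at the zeros of [f] as well. *)
Lemma hardy_phase_covariance (R : realType) (n : nat) (p q : R) (u v : 'rV[R]_n -> R)
    (U V : 'I_n -> 'rV[R]_n -> R) (M : R) :
  continuous u -> continuous v ->
  (forall j, continuous (U j)) -> (forall j, continuous (V j)) ->
  (forall j x,
    is_derive (0 : R) (1 : R) (fun s => u (x + s *: delta_mx ord0 j)) (U j x)) ->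
  (forall j x,
    is_derive (0 : R) (1 : R) (fun s => v (x + s *: delta_mx ord0 j)) (V j x)) ->
  (forall (x : 'rV[R]_n) i, M < `|x ord0 i| -> u x = 0) ->
  (forall (x : 'rV[R]_n) i, M < `|x ord0 i| -> v x = 0) ->
  2 < p -> 0 < q -> q < n%:R ->
  let r2 x := u x ^+ 2 + v x ^+ 2 in
  let Q (x : 'rV[R]_n) := \sum_j x ord0 j ^+ 2 in
  let T j x := u x * V j x - v x * U j x in
  is_true ((((n%:R - q) / p)%:E *
     \int[lebesgue_rV n]_x (r2 x `^ (p / 2) * Q x `^ (- (q / 2)))%:E) ^+ 2 +
   (\int[lebesgue_rV n]_x (Num.sqrt (\sum_j T j x ^+ 2) * r2 x `^ (- 2^-1) *
      (r2 x `^ ((p - 1) / 2) * Q x `^ ((1 - q) / 2)))%:E) ^+ 2 <=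
   (\int[lebesgue_rV n]_x (\sum_j (U j x ^+ 2 + V j x ^+ 2))%:E) *
   (\int[lebesgue_rV n]_x ((r2 x `^ ((p - 1) / 2) * Q x `^ ((1 - q) / 2)) ^+ 2)%:E))%E.
Proof.
move=> cu cv cU cV dU dV u0 v0 p2 q0 qn r2 Q T.
pose S j x := u x * U j x + v x * V j x.
have r20 x : 0 <= r2 x by rewrite addr_ge0 ?sqr_ge0.
have cr2 : continuous r2 by apply: continuous_addr; exact: continuous_sqr.
have cQ : continuous Q.
  by apply: continuous_sum => j; apply: continuous_sqr; exact: coord_continuous.
have cS2 : continuous (fun x => \sum_j S j x ^+ 2).
  apply: continuous_sum => j; apply: continuous_sqr.
  by apply: continuous_addr; exact: continuous_mulr.
have cT2 : continuous (fun x => \sum_j T j x ^+ 2).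
  apply: continuous_sum => j; apply: continuous_sqr.
  by apply: continuous_subr; exact: continuous_mulr.
pose a x := Num.sqrt (\sum_j S j x ^+ 2) * r2 x `^ (- 2^-1).
pose b x := Num.sqrt (\sum_j T j x ^+ 2) * r2 x `^ (- 2^-1).
pose B x := r2 x `^ ((p - 1) / 2) * Q x `^ ((1 - q) / 2).
have a0 x : 0 <= a x by rewrite mulr_ge0 ?sqrtr_ge0 ?powR_ge0.
have b0 x : 0 <= b x by rewrite mulr_ge0 ?sqrtr_ge0 ?powR_ge0.
have B0 x : 0 <= B x by rewrite mulr_ge0 ?powR_ge0.
have ma : measurable_fun [set: 'rV[measurableTypeR R]_n] a.
  by apply: measurable_funM; [exact: measurable_sqrt_rV|exact: measurable_powR_rV].
have mb : measurable_fun [set: 'rV[measurableTypeR R]_n] b.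
  by apply: measurable_funM; [exact: measurable_sqrt_rV|exact: measurable_powR_rV].
have mB : measurable_fun [set: 'rV[measurableTypeR R]_n] B.
  by apply: measurable_funM; exact: measurable_powR_rV.
have msqr (f : 'rV[measurableTypeR R]_n -> R) : measurable_fun setT f ->
    measurable_fun setT (fun x => (f x ^+ 2)%:E).
  by move=> mf; apply/measurable_EFinP; exact: measurable_funX.
have ab_le x : a x ^+ 2 + b x ^+ 2 <= \sum_j (U j x ^+ 2 + V j x ^+ 2).
  rewrite !exprMn !sqr_sqrtr ?sumr_ge0//; do 2?by move=> j _; exact: sqr_ge0.
  rewrite -mulrDl -big_split/= -(powR_mulrn 2 (powR_ge0 _ _)) -powRrM.
  rewrite mulNr mulVf ?pnatr_eq0//.
  rewrite powR_inv1//.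
  have [->|r2x] := eqVneq (r2 x) 0.
    by rewrite invr0 mulr0 sumr_ge0// => j _; rewrite addr_ge0 ?sqr_ge0.
  rewrite ler_pdivrMr ?lt0r ?r2x ?r20// mulr_suml ler_sum// => j _.
  by rewrite le_eqVlt; apply/orP; left; apply/eqP; rewrite /S /T /r2; ring.
have aBE x : a x * B x = r2 x `^ (p / 2 - 1) * Num.sqrt (\sum_j S j x ^+ 2) *
    Q x `^ ((1 - q) / 2).
  have <- : r2 x `^ (- 2^-1) * r2 x `^ ((p - 1) / 2) = r2 x `^ (p / 2 - 1).
    have [->|r2x] := eqVneq (r2 x) 0.
      rewrite [X in X * _]powR0 ?oppr_eq0 ?invr_eq0 ?pnatr_eq0// mul0r powR0//.
      by rewrite gt_eqF// subr_gt0 ltr_pdivlMr// mul1r.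
    by rewrite -powRD ?r2x ?implybT//; congr (_ `^ _); field.
  rewrite /a /B; move: (Num.sqrt _) (_ `^ (- _)).
  move: (_ `^ ((p - 1) / 2)) (_ `^ ((1 - q) / 2)).
  by move=> y1 y2 y3 y4; ring.
have HI : (((n%:R - q) / p)%:E *
     \int[lebesgue_rV n]_x (r2 x `^ (p / 2) * Q x `^ (- (q / 2)))%:E <=
    \int[lebesgue_rV n]_x (a x * B x)%:E)%E.
  under [X in (_ <= X)%E]eq_integral do rewrite aBE.
  exact: (hardy_weighted cu cv cU cV dU dV u0 v0 p2 q0 qn).
have I0 (f : 'rV[measurableTypeR R]_n -> R) : (forall x, 0 <= f x) ->
    (0 <= \int[lebesgue_rV n]_x (f x)%:E)%E.
  by move=> f0; apply: integral_ge0 => x _; rewrite lee_fin.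
apply: (@le_trans _ _ ((\int[lebesgue_rV n]_x (a x ^+ 2)%:E +
     \int[lebesgue_rV n]_x (b x ^+ 2)%:E) *
     \int[lebesgue_rV n]_x (B x ^+ 2)%:E)%E); last first.
  apply: lee_wpmul2r; first by apply: I0 => x; exact: sqr_ge0.
  rewrite -ge0_integralD//; try exact: msqr; try by move=> x _; rewrite lee_fin sqr_ge0.
  apply: ge0_le_integral => //.
  - by move=> x _; rewrite adde_ge0 ?lee_fin ?sqr_ge0.
  - by apply: emeasurable_funD; exact: msqr.
  - apply/measurable_EFinP; apply: continuous_measurable_rV.
    by apply: continuous_sum => j; apply: continuous_addr; exact: continuous_sqr.
  - by move=> x _; rewrite -EFinD lee_fin.
rewrite ge0_muleDl; try by apply: I0 => x; exact: sqr_ge0.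
apply: leeD; last exact: cauchy_schwarz_integral.
apply: le_trans (cauchy_schwarz_integral _ ma mB a0 B0).
rewrite !expe2; apply: lee_pmul => //.
- apply: mule_ge0; last by apply: I0 => x; rewrite mulr_ge0 ?powR_ge0.
  by rewrite lee_fin divr_ge0 ?subr_ge0 ?(ltW qn)// ltW// (lt_trans _ p2).
- apply: mule_ge0; last by apply: I0 => x; rewrite mulr_ge0 ?powR_ge0.
  by rewrite lee_fin divr_ge0 ?subr_ge0 ?(ltW qn)// ltW// (lt_trans _ p2).
Qed.

Theorem theorem1p2 (R : realType) (n : nat) (p q : R) (u v : 'rV[R]_n -> R)
    (hu : smooth_compact_support u) (hv : smooth_compact_support v)
    (hq0 : 0 < q) (hq2 : q < 2) (hp : 2 < p)
    (hn2 : (2 < n)%N) (hn : n%:R < 2 * (p - q) / (p - 2)) :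
  let f : 'rV[R]_n -> R[i] := fun x => u x +i* v x in
  ((\int[lebesgue_rV n]_x (hnorm (cgrad f x) ^+ 2)%:E)
   * (\int[lebesgue_rV n]_x
        (cmod (f x) `^ (2 * p - 2) / enorm x `^ (2 * q - 2))%:E)
   >= ((n%:R - q) ^+ 2 / p ^+ 2)%:E
      * (\int[lebesgue_rV n]_x (cmod (f x) `^ p / enorm x `^ q)%:E) ^+ 2
      + (COV p q f) ^+ 2)%E.
Proof.
cbv zeta; set f : 'rV[R]_n -> R[i] := fun x => u x +i* v x.
have [Mu u0] := compact_support_box hu.2; have [Mv v0] := compact_support_box hv.2.
pose M := Num.max Mu Mv.
have u0M (x : 'rV[R]_n) i : M < `|x ord0 i| -> u x = 0.
  by rewrite gt_max => /andP[/u0].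
have v0M (x : 'rV[R]_n) i : M < `|x ord0 i| -> v x = 0.
  by rewrite gt_max => /andP[_ /v0].
have qn : q < n%:R by rewrite (lt_trans hq2)// ltr_nat.
have cu : continuous u := (hu.1 [::]).1.
have cv : continuous v := (hv.1 [::]).1.
have cU j : continuous (partial j u) := (hu.1 [:: j]).1.
have cV j : continuous (partial j v) := (hv.1 [:: j]).1.
have dU j x := is_derive_line ((hu.1 [::]).2 x j).
have dV j x := is_derive_line ((hv.1 [::]).2 x j).
have main := hardy_phase_covariance cu cv cU cV dU dV u0M v0M hp hq0 qn.
pose r2 x := u x ^+ 2 + v x ^+ 2.
pose Q (x : 'rV[R]_n) := \sum_j x ord0 j ^+ 2.
pose T j x := u x * partial j v x - v x * partial j u x.
have r20 x : 0 <= r2 x by rewrite addr_ge0 ?sqr_ge0.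
have Q0 x : 0 <= Q x by rewrite sumr_ge0// => j _; exact: sqr_ge0.
have cmodE x r : cmod (f x) `^ r = r2 x `^ (r / 2).
  by rewrite -powR_sqrt.
have enormE (x : 'rV[R]_n) r : enorm x `^ r = Q x `^ (r / 2).
  by rewrite -powR_sqrt.
have p0 : 0 < p by rewrite (lt_trans _ hp).
have -> : (\int[lebesgue_rV n]_x (hnorm (cgrad f x) ^+ 2)%:E =
  \int[lebesgue_rV n]_x (\sum_j (partial j u x ^+ 2 + partial j v x ^+ 2))%:E)%E.
  apply: eq_integral => x _; rewrite hnorm_cgrad big_split/=; congr (_ + _)%:E.
    rewrite sqr_sqrtr ?sumr_ge0//; last by move=> j _; exact: sqr_ge0.
    by apply: eq_bigr => j _; rewrite mxE.
  rewrite sqr_sqrtr ?sumr_ge0//; last by move=> j _; exact: sqr_ge0.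
  by apply: eq_bigr => j _; rewrite mxE.
have -> : (\int[lebesgue_rV n]_x
    (cmod (f x) `^ (2 * p - 2) / enorm x `^ (2 * q - 2))%:E =
  \int[lebesgue_rV n]_x ((r2 x `^ ((p - 1) / 2) * Q x `^ ((1 - q) / 2)) ^+ 2)%:E)%E.
  apply: eq_integral => x _; rewrite cmodE enormE -powRN exprMn.
  by rewrite -!powR_mulrn ?powR_ge0// -!powRrM; congr (_ `^ _ * _ `^ _)%:E; field.
have -> : (\int[lebesgue_rV n]_x (cmod (f x) `^ p / enorm x `^ q)%:E =
   \int[lebesgue_rV n]_x (r2 x `^ (p / 2) * Q x `^ (- (q / 2)))%:E)%E.
  by apply: eq_integral => x _; rewrite cmodE enormE powRN.
have -> : COV p q f = (\int[lebesgue_rV n]_x (Num.sqrt (\sum_j T j x ^+ 2) *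
      r2 x `^ (- 2^-1) * (r2 x `^ ((p - 1) / 2) * Q x `^ ((1 - q) / 2)))%:E)%E.
  apply: eq_integral => x _; congr EFin; rewrite cmodE enormE.
  rewrite (_ : enorm _ = Num.sqrt (\sum_j T j x ^+ 2) / r2 x); last first.
    rewrite /enorm -[X in _ / X]ger0_norm// -sqrtr_sqr -sqrtrV ?sqr_ge0//.
    rewrite -sqrtrM ?sumr_ge0//; last by move=> j _; exact: sqr_ge0.
    rewrite mulr_suml; congr Num.sqrt; apply: eq_bigr => j _.
    rewrite mxE exprMn exprVn; congr (_ * (_ ^+ 2)^-1).
    by apply: sqr_sqrtr; exact: r20.
  rewrite -powRN (_ : - ((q - 1) / 2) = (1 - q) / 2); last by field.
  have [r2x|r2x] := eqVneq (r2 x) 0.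
    by rewrite r2x invr0 !mulr0 powR0 ?oppr_eq0 ?invr_eq0 ?pnatr_eq0// mulr0 mul0r.
  have E : r2 x `^ (p / 2) / r2 x = r2 x `^ (- 2^-1) * r2 x `^ ((p - 1) / 2).
    rewrite -(powR_inv1 (r20 x)) -!powRD ?r2x ?implybT//.
    by congr (_ `^ _); field.
  move: E; move: (_ `^ (p / 2)) (_ `^ (- _)) (_ `^ ((p - 1) / 2)) (_ `^ ((1 - q) / 2)).
  move: (r2 x)^-1 (Num.sqrt _) => r y h c d k E.
  by transitivity (y * (h * r) * k); [ring|rewrite E; ring].
rewrite (_ : (n%:R - q) ^+ 2 / p ^+ 2 = (n%:R - q) / p * ((n%:R - q) / p)); last first.
  by field; rewrite gt_eqF.
rewrite EFinM expe2 muleACA -expe2; exact: main.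
Qed.
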